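(* Let $n\geq 2$ and let $G=\mathrm{SO}_n\times\mathrm{GL}_{n-1}\times\cdots\times\mathrm{GL}_1$ act on the complex vector space $$E_n=\mathrm{Mat}_{n,n-1}\oplus\mathrm{Mat}_{n-1,n-2}\oplus\cdots\oplus\mathrm{Mat}_{2,1}$$ by $$(A_n,A_{n-1},\ldots,A_1).(X_{n-1},\ldots,X_1)=(A_nX_{n-1}A_{n-1}^\top,\ A_{n-1}X_{n-2}A_{n-2}^\top,\ \ldots,\ A_2X_1A_1^\top),$$ where $A_n\in\mathrm{SO}_n$, $A_k\in\mathrm{GL}_k$ for $1\le k\le n-1$ and $X_k\in\mathrm{Mat}_{k+1,k}$. Then $(G,E_n)$ is an étale module.
   Context: All algebraic groups are over $\mathbb{C}$. $\mathrm{Mat}_{m,k}$ is the space of complex $m\times k$-matrices. $\mathrm{SO}_n$ is the subgroup of $\mathrm{SL}_n$ preserving the bilinear form on $\mathbb{C}^n$ represented by the identity matrix $I_n$. An étale module for an algebraic group $G$ is a finite-dimensional complex vector space $V$ with a rational representation of $G$ that has a Zariski-open orbit in $V$ and satisfies $\dim G=\dim V$. *)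

(* Defs.v *)
From HB Require Import structures.
From mathcomp Require Import all_boot all_order all_algebra.
From mathcomp Require Import reals complex mpoly.

Set Implicit Arguments.
Unset Strict Implicit.
Unset Printing Implicit Defensive.

Import GRing.Theory.
Local Open Scope ring_scope.

Section AlgebraicGeometry.
Variable K : closedFieldType.

Inductive generated_algebra (X : Type) (S : (X -> K) -> Prop) :
    (X -> K) -> Prop :=
| generated_base f : S f -> generated_algebra S f
| generated_const c : generated_algebra S (fun=> c)
| generated_add f g : generated_algebra S f -> generated_algebra S g ->
    generated_algebra S (fun x => f x + g x)
| generated_mul f g : generated_algebra S f -> generated_algebra S g ->
    generated_algebra S (fun x => f x * g x).

Definition polynomial_function (V : vectType K) : (V -> K) -> Prop :=
  generated_algebra (fun f => exists phi : {scalar V}, f = phi).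

Definition zariski_closed (V : vectType K) (Z : V -> Prop) : Prop :=
  exists S : (V -> K) -> Prop,
    (forall f, S f -> polynomial_function f) /\
    (forall v, Z v <-> (forall f, S f -> f v = 0)).

Definition zariski_open (V : vectType K) (U : V -> Prop) : Prop :=
  zariski_closed (fun v => ~ U v).

(* An affine variety is given by its set X of K-points and its algebra
   O : (X -> K) -> Prop of regular functions. It must be isomorphic, via some
   coordinates x_1, ..., x_N, to a Zariski closed subset of K^N with the
   restrictions of the polynomial functions. *)
Definition affine_variety (X : Type) (O : (X -> K) -> Prop) : Prop :=
  exists (N : nat) (x : 'I_N -> X -> K),
    let coordinates p : 'rV[K]_N := \row_i x i p in
    [/\ injective coordinates,
        zariski_closed (fun r => exists p, r = coordinates p)
      & forall f, O f <-> generated_algebra (fun g => exists i, g = x i) f].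

Definition regular_map (X Y : Type) (OX : (X -> K) -> Prop)
    (OY : (Y -> K) -> Prop) (h : X -> Y) : Prop :=
  forall f, OY f -> OX (fun p => f (h p)).

Definition product_regular (X Y : Type) (OX : (X -> K) -> Prop)
    (OY : (Y -> K) -> Prop) : (X * Y -> K) -> Prop :=
  generated_algebra (fun h =>
    (exists2 f, OX f & h = (fun p => f p.1)) \/
    (exists2 g, OY g & h = (fun p => g p.2))).

Definition algebraically_independent (X : Type) (d : nat)
    (f : 'I_d -> X -> K) : Prop :=
  forall P : {mpoly K[d]}, (forall x, P.@[fun i => f i x] = 0) -> P = 0.

(* The dimension of an affine variety is the transcendence degree over K of
   its coordinate ring (for a reducible variety this is the maximum of the
   transcendence degrees of the function fields of the components). *)
Definition has_dimension (X : Type) (O : (X -> K) -> Prop) (d : nat) : Prop :=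
  (exists f : 'I_d -> X -> K,
     (forall i, O (f i)) /\ algebraically_independent f) /\
  (forall e (f : 'I_e -> X -> K),
     (forall i, O (f i)) -> algebraically_independent f -> (e <= d)%N).

Definition algebraic_group (G : groupType) (O : (G -> K) -> Prop) : Prop :=
  [/\ affine_variety O,
      regular_map (product_regular O O) O (fun p => p.1 * p.2)%g
    & regular_map O O (fun g => g^-1)%g].

Definition rational_representation (G : groupType) (O : (G -> K) -> Prop)
    (V : vectType K) (act : G -> V -> V) : Prop :=
  [/\ forall v, act 1%g v = v,
      forall g h v, act (g * h)%g v = act g (act h v),
      forall g, linear (act g)
    & forall v (phi : {scalar V}), O (fun g => phi (act g v))].

Definition etale_module (G : groupType) (O : (G -> K) -> Prop)
    (V : vectType K) (act : G -> V -> V) : Prop :=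
  [/\ algebraic_group O,
      rational_representation O act,
      exists v, zariski_open (fun w => exists g, w = act g v)
    & has_dimension O (\dim {:V})].

End AlgebraicGeometry.

(* External direct sum of a finite family of vector spaces, which the library
   only has for constant families and binary sums. *)
Section DirectSum.
Variables (K : fieldType) (p : nat) (V : 'I_p -> vectType K).

Local Notation dsum := {dffun forall i : 'I_p, V i}.
Implicit Types (f g h : dsum) (a b : K).

Definition dsum0 : dsum := [ffun i => 0 : V i].
Definition dsum_opp f : dsum := [ffun i => - f i : V i].
Definition dsum_add f g : dsum := [ffun i => f i + g i : V i].
Definition dsum_scale a f : dsum := [ffun i => a *: f i : V i].

Fact dsum_addA : associative dsum_add.
Proof. by move=> f g h; apply/ffunP=> i; rewrite !ffunE addrA. Qed.
Fact dsum_addC : commutative dsum_add.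
Proof. by move=> f g; apply/ffunP=> i; rewrite !ffunE addrC. Qed.
Fact dsum_add0 : left_id dsum0 dsum_add.
Proof. by move=> f; apply/ffunP=> i; rewrite !ffunE add0r. Qed.
Fact dsum_addN : left_inverse dsum0 dsum_opp dsum_add.
Proof. by move=> f; apply/ffunP=> i; rewrite !ffunE addNr. Qed.

HB.instance Definition _ :=
  GRing.isZmodule.Build dsum dsum_addA dsum_addC dsum_add0 dsum_addN.

Fact dsum_scaleA a b f : dsum_scale a (dsum_scale b f) = dsum_scale (a * b) f.
Proof. by apply/ffunP=> i; rewrite !ffunE scalerA. Qed.
Fact dsum_scale1 : left_id 1 dsum_scale.
Proof. by move=> f; apply/ffunP=> i; rewrite !ffunE scale1r. Qed.
Fact dsum_scaleDr : right_distributive dsum_scale +%R.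
Proof. by move=> a f g; apply/ffunP=> i; rewrite !ffunE scalerDr. Qed.
Fact dsum_scaleDl f : {morph dsum_scale^~ f : a b / a + b}.
Proof. by move=> a b; apply/ffunP=> i; rewrite !ffunE scalerDl. Qed.

HB.instance Definition _ := GRing.Zmodule_isLmodule.Build K dsum
  dsum_scaleA dsum_scale1 dsum_scaleDr dsum_scaleDl.

Import VectorInternalTheory.

Fact dsum_vect_iso : Vector.axiom (\sum_i dim (V i)) dsum.
Proof.
exists (fun f => \mxrow_i v2r (f i)) => [a f g|].
  rewrite -[RHS]submxrowK; apply/eq_mxrow=> i.
  have -> B C : submxrow (a *: B + C) i = a *: submxrow B i + submxrow C i.
    by apply/matrixP=> r c; rewrite !mxE.
  by rewrite !mxrowK !ffunE linearP.
exists (fun r => [ffun i => r2v (submxrow r i) : V i]) => [f|r].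
  by apply/ffunP=> i; rewrite ffunE mxrowK v2rK.
by rewrite -[RHS]submxrowK; apply/eq_mxrow=> i; rewrite ffunE r2vK.
Qed.

HB.instance Definition _ := Lmodule_hasFinDim.Build K dsum dsum_vect_iso.

End DirectSum.

Section SOGLTower.
Variables (K : fieldType) (n : nat).

Definition special_orthogonal m (A : 'M[K]_m) : bool :=
  (A^T *m 1%:M *m A == 1%:M) && (\det A == 1).

(* The family (A_n, ..., A_1) is indexed from 0: its component at k : 'I_n is
   A_(k+1), which lies in GL_(k+1) for k + 1 < n and in SO_n for k + 1 = n. *)
Local Notation tower_family := {dffun forall k : 'I_n, 'M[K]_k.+1}.

Definition in_tower (A : tower_family) : bool :=
  [forall k : 'I_n, if k.+1 == n then special_orthogonal (A k)
                    else A k \in unitmx].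

Record tower_group := TowerGroup {
  tower_val :> tower_family;
  _ : in_tower tower_val }.

HB.instance Definition _ := [isSub for tower_val].
HB.instance Definition _ := [Choice of tower_group by <:].

Definition tower_family1 : tower_family := [ffun k : 'I_n => 1%:M : 'M_k.+1].
Definition tower_family_mul (A B : tower_family) : tower_family :=
  [ffun k : 'I_n => A k *m B k : 'M_k.+1].
Definition tower_family_inv (A : tower_family) : tower_family :=
  [ffun k : 'I_n => invmx (A k) : 'M_k.+1].

Fact special_orthogonal_unit m (A : 'M[K]_m) :
  special_orthogonal A -> A \in unitmx.
Proof. by case/andP=> _ /eqP dA; rewrite unitmxE dA unitr1. Qed.

Fact tower_unit (A : tower_group) k : A k \in unitmx.
Proof.
case: A => A /= /forallP/(_ k).
by case: ifP => // _ /special_orthogonal_unit.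
Qed.

Fact in_tower1 : in_tower tower_family1.
Proof.
apply/forallP=> k; rewrite ffunE unitmx1; case: ifP => // _.
by rewrite /special_orthogonal trmx1 !mulmx1 det1 !eqxx.
Qed.

Fact in_tower_mul (A B : tower_group) : in_tower (tower_family_mul A B).
Proof.
apply/forallP=> k; rewrite ffunE.
case: A B => [A /= /forallP/(_ k) hA] [B /= /forallP/(_ k)].
move: hA; case: ifP => [_|_ uA uB]; last by rewrite unitmx_mul uA uB.
rewrite /special_orthogonal !mulmx1.
case/andP=> /eqP oA /eqP dA /andP[/eqP oB /eqP dB].
rewrite det_mulmx dA dB mulr1 eqxx andbT trmx_mul mulmxA.
by rewrite -(mulmxA (B k)^T) oA mulmx1 oB.
Qed.

Fact in_tower_inv (A : tower_group) : in_tower (tower_family_inv A).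
Proof.
apply/forallP=> k; rewrite ffunE; have uA := tower_unit A k.
case: A uA => [A /= /forallP/(_ k)]; case: ifP => [_|_ _ uA]; last first.
  by rewrite unitmx_inv.
rewrite /special_orthogonal !mulmx1 => /andP[/eqP oA /eqP dA] uA.
rewrite det_inv dA invr1 eqxx andbT.
have AV : (A k)^T = invmx (A k) by rewrite -[LHS](mulmxK uA) oA mul1mx.
by rewrite -AV trmxK AV mulmxV.
Qed.

Definition tower1 : tower_group := TowerGroup in_tower1.
Definition tower_mul (A B : tower_group) : tower_group :=
  TowerGroup (in_tower_mul A B).
Definition tower_inv (A : tower_group) : tower_group :=
  TowerGroup (in_tower_inv A).

Fact tower_mulA : associative tower_mul.
Proof.
by move=> A B C; apply/val_inj/ffunP=> k; rewrite !ffunE mulmxA.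
Qed.
Fact tower_mul1g : left_id tower1 tower_mul.
Proof. by move=> A; apply/val_inj/ffunP=> k; rewrite !ffunE mul1mx. Qed.
Fact tower_mulg1 : right_id tower1 tower_mul.
Proof. by move=> A; apply/val_inj/ffunP=> k; rewrite !ffunE mulmx1. Qed.
Fact tower_mulVg : left_inverse tower1 tower_inv tower_mul.
Proof.
by move=> A; apply/val_inj/ffunP=> k; rewrite !ffunE mulVmx ?tower_unit.
Qed.
Fact tower_mulgV : right_inverse tower1 tower_inv tower_mul.
Proof.
by move=> A; apply/val_inj/ffunP=> k; rewrite !ffunE mulmxV ?tower_unit.
Qed.

HB.instance Definition _ := isGroup.Build tower_group
  tower_mulA tower_mul1g tower_mulg1 tower_mulVg tower_mulgV.

(* The family (X_(n-1), ..., X_1) is indexed from 0: its component at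
   k : 'I_n.-1 is X_(k+1). *)
Definition tower_space := {dffun forall k : 'I_n.-1, 'M[K]_(k.+2, k.+1)}.
HB.instance Definition _ := Vector.on tower_space.

Fact lower_subproof (k : 'I_n.-1) : (k < n)%N.
Proof. exact: leq_trans (ltn_ord k) (leq_pred n). Qed.
Fact upper_subproof (k : 'I_n.-1) : (k.+1 < n)%N.
Proof. by case: n k => [[]|m k] //=; rewrite ltnS. Qed.
Definition lower (k : 'I_n.-1) : 'I_n := Ordinal (lower_subproof k).
Definition upper (k : 'I_n.-1) : 'I_n := Ordinal (upper_subproof k).

Definition tower_action (A : tower_group) (X : tower_space) : tower_space :=
  [ffun k : 'I_n.-1 =>
     A (upper k) *m X k *m (A (lower k))^T : 'M[K]_(k.+2, k.+1)].

End SOGLTower.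

(* The coordinate ring of the closed subgroup SO_n x GL_(n-1) x ... x GL_1 of
   GL_n x GL_(n-1) x ... x GL_1: it is generated by the matrix entries and the
   inverses of the determinants of all the components. *)
Definition tower_regular (K : closedFieldType) (n : nat) :
    (tower_group K n -> K) -> Prop :=
  generated_algebra (fun f =>
    (exists (k : 'I_n) (i j : 'I_k.+1),
       f = (fun A : tower_group K n => A k i j)) \/
    (exists k : 'I_n, f = (fun A : tower_group K n => (\det (A k))^-1))).

(* Main.v *)
From HB Require Import structures.
Require Import Defs.
From mathcomp Require Import all_boot all_order all_algebra.
From mathcomp Require Import reals complex.
From mathcomp Require boolp.
From mathcomp Require Import mpoly.

(** The orbit. Take as base point the tuple of frames, the injections of
    [K^k] onto the last [k] coordinates of [K^(k+1)]. A tuple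
    [X = (X_(n-1), ..., X_1)] carries a chain of symmetric forms: start from
    the identity on [K^n] and put [S_k = X_k^T S_(k+1)^-1 X_k]. An element
    [A] of the group turns [S_k] into [A_k S_k A_k^T], so nondegeneracy of the
    whole chain is preserved, and it holds at the base point. Conversely, if
    every [S_k] is nondegenerate, factor them as [S_k = A_k A_k^T] starting
    from the smallest one: [Y = X_k A_k^(-T)] has orthonormal columns for
    [S_(k+1)^-1], and completing [Y] by one more vector gives an [A_(k+1)] that
    factors [S_(k+1)] and carries the frame to [Y]
    ([orthonormal_extension], [gram_transitive]). At the top [S_n = 1], so
    [A_n] is orthogonal, and the free sign of the last vector makes its
    determinant 1. Hence the orbit is exactly the locus where the chain is
    nondegenerate. Replacing inverses by adjugates only rescales the forms
    ([gram_adj_invmx]) and exhibits this locus as the complement of the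
    hypersurface of one polynomial, [tower_semi_invariant].

    The dimension. Pulling the coordinates of the space back along the orbit
    map gives algebraically independent regular functions, because the image
    is the non-vanishing locus of a nonzero polynomial
    ([dominant_map_independent]). For the upper bound the group is covered by
    finitely many charts, in each of which every regular function is a fraction
    of polynomials in [\dim E_n] parameters: the entries of the [GL] factors and
    the Cayley transform of the orthogonal factor after a change of signs
    ([rational_tower_regular]). A monomial count shows that more than [d]
    fractions in [d] parameters are dependent ([fractions_dependent]), and
    the product of the relations found in the charts is a relation on the whole
    group ([independent_size]). *)

Set Implicit Arguments.
Unset Strict Implicit.
Unset Printing Implicit Defensive.

Import GRing.Theory.
Local Open Scope ring_scope.

(** * Algebras of functions *)

Section FunctionAlgebra.
Variables (K : fieldType) (X : Type) (O : (X -> K) -> Prop).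

(** The closure conditions common to regular functions, to polynomial functions
    and to functions that are rational in a chart; matrix operations are shown
    once to stay inside any of them. *)
Definition function_algebra : Prop :=
  [/\ forall c, O (fun=> c),
      forall f g, O f -> O g -> O (fun x => f x + g x)
    & forall f g, O f -> O g -> O (fun x => f x * g x)].

Lemma algebra_ext f g : O f -> f =1 g -> O g.
Proof. by move=> Of /boolp.funext <-. Qed.

Hypothesis algO : function_algebra.

Lemma algebra_const c : O (fun=> c).
Proof. by case: algO. Qed.

Lemma algebra_add f g : O f -> O g -> O (fun x => f x + g x).
Proof. by case: algO => _ + _; apply. Qed.

Lemma algebra_mul f g : O f -> O g -> O (fun x => f x * g x).
Proof. by case: algO => _ _; apply. Qed.

Lemma algebra_opp f : O f -> O (fun x => - f x).
Proof.
move=> Of; apply: (algebra_ext (f := fun x => -1 * f x)); last first.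
  by move=> x; rewrite mulN1r.
exact: algebra_mul (algebra_const _) Of.
Qed.

Lemma algebra_sum I (r : seq I) (P : pred I) (F : I -> X -> K) :
  (forall i, P i -> O (F i)) -> O (fun x => \sum_(i <- r | P i) F i x).
Proof.
move=> OF; elim: r => [|i r IH].
  apply: (algebra_ext (algebra_const 0)) => x.
  by rewrite big_nil.
apply: (algebra_ext (f := fun x =>
  (if P i then F i x else 0) + \sum_(j <- r | P j) F j x)); last first.
  by move=> x; rewrite big_cons; case: ifP; rewrite ?add0r.
apply: algebra_add => //.
by case Pi: (P i); [apply: OF|apply: algebra_const].
Qed.

Lemma algebra_prod I (r : seq I) (P : pred I) (F : I -> X -> K) :
  (forall i, P i -> O (F i)) -> O (fun x => \prod_(i <- r | P i) F i x).
Proof.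
move=> OF; elim: r => [|i r IH].
  apply: (algebra_ext (algebra_const 1)) => x.
  by rewrite big_nil.
apply: (algebra_ext (f := fun x =>
  (if P i then F i x else 1) * \prod_(j <- r | P j) F j x)); last first.
  by move=> x; rewrite big_cons; case: ifP; rewrite ?mul1r.
apply: algebra_mul => //.
by case Pi: (P i); [apply: OF|apply: algebra_const].
Qed.

Definition algebra_mx m n (M : X -> 'M[K]_(m, n)) : Prop :=
  forall i j, O (fun x => M x i j).

Lemma algebra_const_mx m n (C : 'M[K]_(m, n)) : algebra_mx (fun=> C).
Proof. by move=> i j; apply: algebra_const. Qed.

Lemma algebra_trmx m n (M : X -> 'M[K]_(m, n)) :
  algebra_mx M -> algebra_mx (fun x => (M x)^T).
Proof.
move=> OM i j; apply: (algebra_ext (OM j i)) => x.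
by rewrite mxE.
Qed.

Lemma algebra_mulmx m n p (M : X -> 'M[K]_(m, n)) (N : X -> 'M[K]_(n, p)) :
  algebra_mx M -> algebra_mx N -> algebra_mx (fun x => M x *m N x).
Proof.
move=> OM ON i j.
apply: (algebra_ext (f := fun x => \sum_k M x i k * N x k j)); last first.
  by move=> x; rewrite mxE.
by apply: algebra_sum => k _; apply: algebra_mul.
Qed.

Lemma algebra_det n (M : X -> 'M[K]_n) :
  algebra_mx M -> O (fun x => \det (M x)).
Proof.
move=> OM; rewrite /determinant; apply: algebra_sum => s _.
apply: algebra_mul; first exact: algebra_const.
by apply: algebra_prod => i _; apply: OM.
Qed.

Lemma algebra_adj n (M : X -> 'M[K]_n) :
  algebra_mx M -> algebra_mx (fun x => \adj (M x)).
Proof.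
move=> OM i j.
apply: (algebra_ext (f := fun x =>
  (-1) ^+ (j + i) * \det (row' j (col' i (M x))))); last first.
  by move=> x; rewrite mxE.
apply: algebra_mul; first exact: algebra_const.
apply: algebra_det => k l; apply: (algebra_ext (OM _ _)) => x.
by rewrite !mxE.
Qed.

End FunctionAlgebra.

Lemma function_algebra_comp (K : fieldType) (X Y : Type)
    (O : (X -> K) -> Prop) (h : X -> Y) :
  function_algebra O -> function_algebra (fun f => O (f \o h)).
Proof.
move=> algO; split=> [c|f g|f g]; first exact: algebra_const.
  exact: algebra_add.
exact: algebra_mul.
Qed.

Section GeneratedAlgebra.
Variables (K : closedFieldType) (X : Type) (S : (X -> K) -> Prop).

Lemma generated_function_algebra : function_algebra (generated_algebra S).
Proof.
split; [exact: generated_const|exact: generated_add|exact: generated_mul].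
Qed.

(** Regularity of a pullback, and rationality in a chart, are themselves function
    algebras, so that both need only be tested on generators. *)
Lemma generated_algebra_min (O : (X -> K) -> Prop) :
  function_algebra O -> (forall f, S f -> O f) ->
  forall f, generated_algebra S f -> O f.
Proof.
move=> algO SO f; elim=> [{}f /SO//|c|{}f g _ Of _ Og|{}f g _ Of _ Og].
- exact: algebra_const.
- exact: algebra_add.
- exact: algebra_mul.
Qed.

End GeneratedAlgebra.


(** * Dependence and non-vanishing of multivariate polynomials *)

Lemma msizeM_leq n (R : idomainType) a b (p q : {mpoly R[n]}) :
  (msize p <= a.+1)%N -> (msize q <= b.+1)%N -> (msize (p * q) <= (a + b).+1)%N.
Proof.
have [->|p0] := eqVneq p 0; first by rewrite mul0r msize0.
have [->|q0] := eqVneq q 0; first by rewrite mulr0 msize0.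
rewrite msizeM // => pa qb; have := leq_add pa qb.
by rewrite addSn addnS; case: (msize p + msize q)%N.
Qed.

Lemma msizeX_leq n (R : idomainType) a k (p : {mpoly R[n]}) :
  (msize p <= a.+1)%N -> (msize (p ^+ k) <= (k * a).+1)%N.
Proof.
move=> pa; elim: k => [|k IH]; first by rewrite expr0 msize1.
by rewrite exprS mulSn; apply: msizeM_leq.
Qed.

Lemma msize_prod_leq n (R : idomainType) a e (p : 'I_e -> {mpoly R[n]}) :
  (forall i, msize (p i) <= a.+1)%N -> (msize (\prod_i p i) <= (e * a).+1)%N.
Proof.
elim: e p => [|e IH] p pa; first by rewrite big_ord0 msize1.
rewrite big_ord_recl mulSn; apply: msizeM_leq => //.
exact: IH.
Qed.

Section MonomialBox.
Variables (K : fieldType) (e N : nat) (c : {ffun 'I_e -> 'I_N} -> K).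

(** Monomials with all exponents below [N], indexed by a finite type of known
    cardinality. *)
Definition box_mnm (a : {ffun 'I_e -> 'I_N}) : 'X_{1..e} :=
  [multinom (a i : nat) | i < e].

Lemma box_mnm_inj : injective box_mnm.
Proof.
move=> a b /mnmP eq_ab; apply/ffunP=> i; apply/val_inj.
by have := eq_ab i; rewrite !mnmE.
Qed.

Lemma mcoeff_box (a : {ffun 'I_e -> 'I_N}) :
  (\sum_b c b *: 'X_[box_mnm b])@_(box_mnm a) = c a.
Proof.
rewrite raddf_sum (bigD1 a) //= mcoeffZ mcoeffX eqxx mulr1 big1 ?addr0 //.
by move=> b /negbTE ba; rewrite mcoeffZ mcoeffX (inj_eq box_mnm_inj) ba mulr0.
Qed.

End MonomialBox.

Lemma wide_kernel (K : fieldType) (I J : finType) (M : I -> J -> K) :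
  (#|J| < #|I|)%N ->
  exists2 c : I -> K, (exists i, c i != 0)
                    & forall j, \sum_i c i * M i j = 0.
Proof.
move=> ltJI.
pose A := \matrix_(i < #|I|, j < #|J|) M (enum_val i) (enum_val j).
have : kermx A != 0.
  rewrite kermx_eq0 /row_free; apply: contraTneq ltJI => <-.
  by rewrite -leqNgt rank_leq_col.
case/rowV0Pn=> v /sub_kermxP vA v0.
exists (fun i => v 0 (enum_rank i)).
  case/rV0Pn: v0 => i vi; exists (enum_val i).
  by rewrite enum_valK.
move=> j; have /matrixP/(_ 0 (enum_rank j)) := vA; rewrite [RHS]mxE => vA0.
rewrite -[RHS]vA0 mxE (reindex enum_rank) /=; last exact/onW_bij/enum_rank_bij.
by apply: eq_bigr => i _; rewrite mxE !enum_rankK.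
Qed.

(** Counting: if [q] and the [r i] have degree at most [D], then the [N ^ e]
    products of powers of the fractions [r i / q] with exponents below [N],
    once multiplied by [q ^ (e * N)], have degree at most [e * N * D] and so
    lie in a space of dimension at most [(e * N * D + 1) ^ d]. Since [d < e],
    this is smaller than [N ^ e] for large [N], and a linear relation between
    the products is a polynomial relation between the fractions. *)
Lemma fractions_dependent (K : fieldType) d e (dlte : (d < e)%N)
    (r : 'I_e -> {mpoly K[d]}) (q : {mpoly K[d]}) :
  exists2 P : {mpoly K[e]}, P != 0 &
    forall u y, q.@[u] != 0 -> (forall i, y i * q.@[u] = (r i).@[u]) ->
    P.@[y] = 0.
Proof.
pose D := maxn (msize q) (\max_i msize (r i)).
have qD : (msize q <= D.+1)%N by rewrite leqW // leq_maxl.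
have rD i : (msize (r i) <= D.+1)%N.
  by rewrite leqW // leq_max orbC (leq_bigmax i).
(* With this N, (e N D + 1)^d <= (e D + 1)^d N^d < N^(d+1) <= N^e. *)
pose N := ((e * D).+1 ^ d).+1.
pose B := (e * (N * D)).+1.
pose h (a : {ffun 'I_e -> 'I_N}) := \prod_i (r i ^+ a i * q ^+ (N - a i)).
have hB a : (msize (h a) <= B)%N.
  apply: msize_prod_leq => i.
  have -> : (N * D = a i * D + (N - a i) * D)%N.
    by rewrite -mulnDl subnKC // ltnW.
  by apply: msizeM_leq; apply: msizeX_leq.
have [|c [a0 ca0] ch] :=
  wide_kernel (I := {ffun 'I_e -> 'I_N}) (J := {ffun 'I_d -> 'I_B})
    (fun a b => (h a)@_(box_mnm b)).
  rewrite !card_ffun !card_ord.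
  apply: (@leq_ltn_trans ((e * D).+1 ^ d * N ^ d)%N).
    rewrite -expnMn; suff leB : (B <= (e * D).+1 * N)%N.
      by elim: (d) => // k IH; rewrite !expnS leq_mul.
    by rewrite /B mulSn -add1n leq_add // [(N * D)%N]mulnC mulnA.
  apply: (@leq_trans (N ^ d.+1)); last by rewrite leq_pexp2l.
  by rewrite expnS ltn_pmul2r // expn_gt0.
exists (\sum_a c a *: 'X_[box_mnm a]).
  apply: contraNneq ca0 => P0; by rewrite -(mcoeff_box c a0) P0 mcoeff0.
have ch0 : \sum_a c a *: h a = 0.
  apply/mpolyP=> m; rewrite mcoeff0 raddf_sum /=.
  have [/forallP mB|] := boolP [forall i, m i < B]%N.
    rewrite -[RHS](ch [ffun i => Ordinal (mB i)]); apply: eq_bigr => a _.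
    rewrite mcoeffZ; congr (_ * _@__).
    by apply/mnmP=> i; rewrite mnmE ffunE.
  case/forallPn=> i; rewrite -leqNgt => Bmi.
  apply: big1 => a _; rewrite mcoeffZ memN_msupp_eq0 ?mulr0 //.
  apply: msize_mdeg_ge; apply: leq_trans (hB a) (leq_trans Bmi _).
  by rewrite mdegE (bigD1 i) //= leq_addr.
move=> u y qu yr.
have : (\sum_a c a *: h a).@[u] = 0 by rewrite ch0 meval0.
have -> : (\sum_a c a *: h a).@[u] =
    (\sum_a c a *: 'X_[box_mnm a]).@[y] * q.@[u] ^+ (e * N).
  rewrite !raddf_sum /= mulr_suml; apply: eq_bigr => a _.
  rewrite !mevalZ -mulrA; congr (_ * _).
  rewrite mevalX rmorph_prod /= exprM.
  have -> : q.@[u] ^+ e ^+ N = \prod_(i < e) q.@[u] ^+ N.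
    by rewrite prodr_const card_ord -!exprM mulnC.
  rewrite -big_split; apply: eq_bigr => i _ /=.
  rewrite mnmE rmorphM !rmorphXn /= -yr exprMn -mulrA -exprD subnKC //.
  exact: ltnW.
by move/eqP; rewrite mulf_eq0 expf_eq0 (negbTE qu) andbF orbF => /eqP.
Qed.

Lemma digits_inj n D (a b : 'I_n -> nat) :
  (forall i, a i < D)%N -> (forall i, b i < D)%N ->
  (\sum_i a i * D ^ i = \sum_i b i * D ^ i)%N -> a =1 b.
Proof.
elim: n a b => [|n IH] a b aD bD; first by move=> _ [].
have split_sum (c : 'I_n.+1 -> nat) :
    (\sum_i c i * D ^ i = (\sum_i c (lift ord0 i) * D ^ i) * D + c ord0)%N.
  rewrite big_ord_recl expn0 muln1 addnC big_distrl /=; congr (_ + _)%N.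
  by apply: eq_bigr => i _; rewrite /bump /= add1n expnSr mulnA.
rewrite !split_sum => eq_ab; have D0 : (0 < D)%N by apply: leq_ltn_trans (aD ord0).
have := congr1 (modn^~ D) eq_ab; rewrite /= !modnMDl !modn_small // => eq0.
move: eq_ab; rewrite eq0 => /addIn/eqP; rewrite eqn_pmul2r // => /eqP/IH eqS i.
by case: (unliftP ord0 i) => [j|] -> //; apply: eqS.
Qed.

(** Kronecker substitution: sending the [i]-th variable to [t ^ (D ^ i)], where [D]
    exceeds all exponents, keeps distinct monomials distinct, which reduces the
    claim to univariate polynomials. *)
Lemma mpoly_nonroot (K : closedFieldType) n (P : {mpoly K[n]}) :
  P != 0 -> exists v, P.@[v] != 0.
Proof.
move=> P0; pose D := msize P.
pose code (m : 'X_{1..n}) := (\sum_i m i * D ^ i)%N.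
have mD m i : m \in msupp P -> (m i < D)%N.
  move/msize_mdeg_lt; apply: leq_ltn_trans.
  by rewrite mdegE (bigD1 i) //= leq_addr.
pose p : {poly K} := \sum_(m <- msupp P) P@_m *: 'X^(code m).
have Pm := mlead_supp P0; set m0 := mlead P in Pm.
have : p != 0.
  apply/eqP => /(congr1 (fun p : {poly K} => p`_(code m0))) /eqP; apply/negP.
  rewrite coef0 coef_sum (bigD1_seq m0) ?msupp_uniq //= big_seq_cond big1.
    by rewrite coefZ coefXn eqxx mulr1 addr0 -mcoeff_msupp.
  move=> m /andP[mP m_m0]; rewrite coefZ coefXn; case: eqP => [eq_m|_].
    case/eqP: m_m0; apply/mnmP; apply: digits_inj (esym eq_m) => i; exact: mD.
  by rewrite mulr0.
case/closed_nonrootP=> t pt; exists (fun i => t ^+ (D ^ i)).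
apply: contra pt => /eqP Pt; apply/eqP; rewrite -Pt mevalE horner_sum.
apply: eq_bigr => m _; rewrite hornerZ hornerXn; congr (_ * _).
by rewrite expr_sum; apply: eq_bigr => i _; rewrite -exprM mulnC.
Qed.


(** * Bounding the dimension by maps to a vector space *)

Section Dimension.
Variables (K : closedFieldType) (V : vectType K).
Local Notation d := (\dim {:V}).

Definition coords (v : V) : 'I_d -> K := fun i => coord (vbasis {:V}) i v.
Definition point (u : 'I_d -> K) : V := \sum_i u i *: (vbasis {:V})`_i.

Lemma pointK u : coords (point u) =1 u.
Proof. by move=> i; rewrite /coords coord_sum_free ?(basis_free (vbasisP _)). Qed.

Lemma coordsK v : point (coords v) = v.
Proof. by rewrite [RHS](coord_vbasis (memvf v)). Qed.

Lemma polynomial_function_algebra : function_algebra (@polynomial_function K V).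
Proof. exact: generated_function_algebra. Qed.

Lemma polynomial_function_scalar (f : V -> K) : scalar f -> polynomial_function f.
Proof.
move=> linf; pose fL := GRing.isLinear.Build _ _ _ _ _ linf.
pose phi : {scalar V} := HB.pack f fL.
by apply: generated_base; exists phi.
Qed.

Lemma polynomial_function_mpoly (F : V -> K) : polynomial_function F ->
  exists P : {mpoly K[d]}, forall v, F v = P.@[coords v].
Proof.
move: F; apply: generated_algebra_min => [|_ [phi ->]].
  split=> [c|f g [P fP] [Q gQ]|f g [P fP] [Q gQ]].
  - by exists c%:MP => v; rewrite mevalC.
  - by exists (P + Q) => v; rewrite mevalD fP gQ.
  - by exists (P * Q) => v; rewrite mevalM fP gQ.
exists (\sum_(i < d) phi (vbasis {:V})`_i *: 'X_i) => v.
rewrite -{1}[v]coordsK linear_sum raddf_sum /=; apply: eq_bigr => i _.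
by rewrite linearZ mevalZ mevalXU mulrC.
Qed.

(** A relation between the pulled back coordinates vanishes on the image of [psi],
    hence its product with [F] vanishes everywhere and is the zero polynomial. *)
Lemma dominant_map_independent (X : Type) (psi : X -> V) (F : V -> K) :
  polynomial_function F -> (exists v, F v != 0) ->
  (forall v, F v != 0 -> exists x, v = psi x) ->
  algebraically_independent (fun i x => coords (psi x) i).
Proof.
case/polynomial_function_mpoly=> Q FQ [v0 Fv0] onto P P0.
apply/eqP/contraT => Pn0.
have Qn0 : Q != 0 by apply: contraNneq Fv0 => Q0; rewrite FQ Q0 meval0.
have [u] := mpoly_nonroot (mulf_neq0 Pn0 Qn0).
rewrite mevalM mulf_eq0 negb_or -!(meval_eq _ (pointK u)) -FQ.
by case/andP=> Pu /onto[x xu]; rewrite xu P0 eqxx in Pu.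
Qed.

Section RationalFunctions.
Variables (X : Type) (D : X -> Prop) (t : X -> V).

(** The denominator may depend on [f], but must have no zero on [t(D)]; thus the
    inverse of a nowhere vanishing function stays rational. *)
Definition rational_in (f : X -> K) : Prop :=
  exists p q, [/\ polynomial_function p, polynomial_function q,
    forall x, D x -> q (t x) != 0 & forall x, D x -> f x * q (t x) = p (t x)].

Let algV := polynomial_function_algebra.

Lemma rational_in_algebra : function_algebra rational_in.
Proof.
split=> [c|f g [p [q [Pp Pq q0 fq]]] [p' [q' [Pp' Pq' q'0 gq]]]
          |f g [p [q [Pp Pq q0 fq]]] [p' [q' [Pp' Pq' q'0 gq]]]].
- exists (fun=> c), (fun=> 1); split=> [||x _|x _]; rewrite ?oner_eq0 ?mulr1 //.
    exact: algebra_const.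
  exact: algebra_const.
- exists (fun v => p v * q' v + p' v * q v), (fun v => q v * q' v); split.
  + by apply: algebra_add => //; apply: algebra_mul.
  + exact: algebra_mul.
  + by move=> x Dx; rewrite mulf_neq0 ?q0 ?q'0.
  + move=> x Dx; rewrite mulrDl -fq // -gq // mulrA; congr (_ + _).
    by rewrite -mulrA [q' _ * _]mulrC.
- exists (fun v => p v * p' v), (fun v => q v * q' v); split.
  + exact: algebra_mul.
  + exact: algebra_mul.
  + by move=> x Dx; rewrite mulf_neq0 ?q0 ?q'0.
  + by move=> x Dx; rewrite -fq // -gq // mulrACA.
Qed.

Lemma rational_in_poly p : polynomial_function p -> rational_in (fun x => p (t x)).
Proof.
move=> Pp; exists p, (fun=> 1); split=> // [|x _|x _]; rewrite ?oner_eq0 ?mulr1 //.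
exact: algebra_const.
Qed.

Lemma rational_in_inv f : (forall x, D x -> f x != 0) ->
  rational_in f -> rational_in (fun x => (f x)^-1).
Proof.
move=> f0 [p [q [Pp Pq q0 fq]]]; exists q, p; split=> // x Dx.
  by rewrite -fq // mulf_neq0 ?f0 ?q0.
by rewrite -fq // mulKf ?f0.
Qed.

Lemma eq_rational_in f g :
  (forall x, D x -> f x = g x) -> rational_in f -> rational_in g.
Proof.
move=> eq_fg [p [q [Pp Pq q0 fq]]]; exists p, q; split=> // x Dx.
by rewrite -eq_fg ?fq.
Qed.

(** The product of the denominators serves as the common denominator that the
    count of monomials requires. *)
Lemma rational_in_dependent e (f : 'I_e -> X -> K) : (d < e)%N ->
  (forall i, rational_in (f i)) ->
  exists2 P : {mpoly K[e]}, P != 0 &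
    forall x, D x -> P.@[fun i => f i x] = 0.
Proof.
move=> ltde ratf.
have /fin_all_exists2[q q0 /fin_all_exists[r fr]] i :
    exists2 q : {mpoly K[d]}, forall x, D x -> q.@[coords (t x)] != 0 &
    exists r : {mpoly K[d]}, forall x, D x ->
      f i x * q.@[coords (t x)] = r.@[coords (t x)].
  have [p [q [/polynomial_function_mpoly[P pP]]]] := ratf i.
  case/polynomial_function_mpoly=> Q qQ q0 fq.
  exists Q => [x Dx|]; first by rewrite -qQ q0.
  by exists P => x Dx; rewrite -qQ -pP fq.
have [P P0 Pf] := fractions_dependent ltde
  (fun i => r i * \prod_(j | j != i) q j) (\prod_j q j).
exists P => // x Dx; apply: (Pf (coords (t x))) => [|i].
  rewrite rmorph_prod /=; apply/prodf_neq0 => j _; exact: q0.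
by rewrite (bigD1 i) //= !mevalM mulrA fr.
Qed.

End RationalFunctions.

(** Each chart yields a nonzero relation valid on it; their product is nonzero and
    valid everywhere. *)
Lemma independent_size (X : Type) (J : finType) (D : J -> X -> Prop)
    (t : J -> X -> V) e (f : 'I_e -> X -> K) :
  (forall x, exists j, D j x) -> (forall i j, rational_in (D j) (t j) (f i)) ->
  algebraically_independent f -> (e <= d)%N.
Proof.
move=> cover ratf indf; rewrite leqNgt; apply/negP => ltde.
have /fin_all_exists2[P P0 Pf] j := rational_in_dependent ltde (ratf^~ j).
have /eqP : \prod_j P j = 0.
  apply: indf => x; have [j Dx] := cover x.
  by rewrite rmorph_prod (bigD1 j) //= Pf // mul0r.
by apply/negP/prodf_neq0 => j _; apply: P0.
Qed.

End Dimension.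


(** * The tower group and its representation *)

Section TowerGroup.
Variables (K : closedFieldType) (n : nat).
Local Notation G := (tower_group K n).
Local Notation O := (@tower_regular K n).

Definition tower_index : finType :=
  ({k : 'I_n & ('I_k.+1 * 'I_k.+1)%type} + 'I_n)%type.

Definition entry_index (k : 'I_n) (i j : 'I_k.+1) : tower_index :=
  inl (Tagged (fun k : 'I_n => ('I_k.+1 * 'I_k.+1)%type) (i, j)).

Definition tower_coordinate (c : tower_index) (A : G) : K :=
  match c with
  | inl (existT k ij) => A k ij.1 ij.2
  | inr k => (\det (A k))^-1
  end.

Lemma tower_function_algebra : function_algebra O.
Proof. exact: generated_function_algebra. Qed.

Lemma tower_regular_entry (k : 'I_n) : algebra_mx O (fun A : G => A k).
Proof. by move=> i j; apply: generated_base; left; exists k, i, j. Qed.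

Lemma tower_regular_detV (k : 'I_n) : O (fun A : G => (\det (A k))^-1).
Proof. by apply: generated_base; right; exists k. Qed.

Lemma tower_regular_min (P : (G -> K) -> Prop) : function_algebra P ->
  (forall k, algebra_mx P (fun A : G => A k)) ->
  (forall k, P (fun A : G => (\det (A k))^-1)) ->
  forall f, O f -> P f.
Proof.
move=> algP Pe Pd; apply: generated_algebra_min => // f.
by case=> [[k [i [j ->]]]|[k ->]]; [apply: Pe | apply: Pd].
Qed.

Lemma tower_val_inj (A B : G) : (forall k, A k = B k) -> A = B.
Proof. by move=> AB; apply/val_inj/ffunP. Qed.

(** Among the equations of the image, those used are [det A_k * z_k = 1], with
    [z_k] the coordinate of the inverse determinant, and the orthogonality and
    determinant equations for the component of size [n]. *)
Lemma tower_affine : affine_variety O.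
Proof.
pose x (i : 'I_#|tower_index|) := tower_coordinate (enum_val i).
have xE c A : x (enum_rank c) A = tower_coordinate c A by rewrite /x enum_rankK.
exists #|tower_index|, x => coordinates; split.
- move=> A B /rowP eqAB; apply: tower_val_inj => k; apply/matrixP=> i j.
  by have := eqAB (enum_rank (entry_index i j)); rewrite !mxE !xE.
(* The full vanishing ideal of the image is taken as system of equations. *)
- exists (fun f => polynomial_function f /\ forall A, f (coordinates A) = 0).
  split=> [f []//|r]; split=> [[A ->] f [_ ->]//|Zr].
  have algP := @polynomial_function_algebra K 'rV[K]_#|tower_index|.
  pose X c (r : 'rV[K]_#|tower_index|) := r 0 (enum_rank c).
  have PX c : polynomial_function (X c).
    by apply: polynomial_function_scalar => a u v; rewrite /X !mxE.
  have XE c A : X c (coordinates A) = tower_coordinate c A by rewrite /X mxE xE.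
  pose M (k : 'I_n) (r : 'rV[K]_#|tower_index|) : 'M[K]_k.+1 :=
    \matrix_(i, j) X (@entry_index k i j) r.
  have PM k : algebra_mx (@polynomial_function K _) (M k).
    by move=> i j; apply: algebra_ext (PX (entry_index i j)) _ => v; rewrite mxE.
  have ME k A : M k (coordinates A) = A k.
    by apply/matrixP=> i j; rewrite mxE XE.
  have vanish f g : polynomial_function f -> polynomial_function g ->
      (forall A, f (coordinates A) = g (coordinates A)) -> f r = g r.
    move=> Pf Pg fg; apply/eqP; rewrite -subr_eq0; apply/eqP.
    apply: (Zr (fun v => f v - g v)); split=> [|A]; last by rewrite fg subrr.
    by apply: algebra_add => //; apply: algebra_opp.
  have detM k : \det (M k r) * X (inr k) r = 1.
    apply: (vanish (fun v => \det (M k v) * X (inr k) v) (fun=> 1)).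
    + by apply: algebra_mul => //; apply: algebra_det.
    + exact: algebra_const.
    by move=> A; rewrite ME XE mulfV // -unitfE -unitmxE tower_unit.
  have detM0 k : \det (M k r) != 0.
    by apply: contra_eq_neq (detM k) => ->; rewrite mul0r eq_sym oner_eq0.
  have towerM : in_tower [ffun k => M k r].
    apply/forallP=> k; rewrite ffunE; case: ifP => [kn|_]; last first.
      by rewrite unitmxE unitfE.
    have soA (A : G) : special_orthogonal (A k).
      by case: A => A /= /forallP/(_ k); rewrite kn.
    apply/andP; split; apply/eqP.
      apply/matrixP=> i j.
      apply: (vanish (fun v => ((M k v)^T *m 1%:M *m M k v) i j) (fun=> 1%:M i j)).
      + apply: algebra_mulmx => //; apply: algebra_mulmx => //.
          exact: algebra_trmx.
        exact: algebra_const_mx.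
      + exact: algebra_const.
      by move=> A; rewrite ME; case/andP: (soA A) => /eqP->.
    apply: (vanish (fun v => \det (M k v)) (fun=> 1)).
    + exact: algebra_det.
    + exact: algebra_const.
    by move=> A; rewrite ME; case/andP: (soA A) => _ /eqP->.
  exists (TowerGroup towerM); apply/rowP=> i.
  have ri : r 0 i = X (enum_val i) r by rewrite /X enum_valK.
  rewrite mxE /x ri.
  case: (enum_val i) => [[k [a b]]|k] /=; rewrite ffunE; first by rewrite mxE.
  by apply: (mulfI (detM0 k)); rewrite detM mulfV.
- have algX := generated_function_algebra (fun g => exists i, g = x i).
  have Xc c : generated_algebra (fun g => exists i, g = x i) (tower_coordinate c).
    by apply: generated_base; exists (enum_rank c); rewrite /x enum_rankK.
  move=> f; split.
    apply: tower_regular_min => [//|k i j|k]; first exact: (Xc (entry_index i j)).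
    exact: (Xc (inr k)).
  apply: generated_algebra_min => [|_ [i ->]]; first exact: tower_function_algebra.
  rewrite /x; case: (enum_val i) => [[k ij]|k]; first exact: tower_regular_entry.
  exact: tower_regular_detV.
Qed.

Lemma tower_mul_regular :
  regular_map (product_regular O O) O (fun p : G * G => p.1 * p.2)%g.
Proof.
have algOO := generated_function_algebra (fun h : G * G -> K =>
    (exists2 f, O f & h = (fun p => f p.1)) \/
    (exists2 g, O g & h = (fun p => g p.2))).
have O1 f : O f -> product_regular O O (fun p => f p.1).
  by move=> Of; apply: generated_base; left; exists f.
have O2 f : O f -> product_regular O O (fun p => f p.2).
  by move=> Of; apply: generated_base; right; exists f.
apply: tower_regular_min => [|k i j|k]; first exact: function_algebra_comp.
  apply: (algebra_ext (f := fun p : G * G => (p.1 k *m p.2 k) i j)); last first.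
    by move=> p; rewrite /= ffunE.
  apply: algebra_mulmx => // a b.
    exact: (O1 _ (tower_regular_entry a b)).
  exact: (O2 _ (tower_regular_entry a b)).
apply: (algebra_ext (f := fun p : G * G => (\det (p.1 k))^-1 * (\det (p.2 k))^-1)).
  apply: algebra_mul => //; first exact: (O1 _ (tower_regular_detV k)).
  exact: (O2 _ (tower_regular_detV k)).
by move=> p; rewrite /= ffunE det_mulmx invfM.
Qed.

Lemma tower_inv_regular : regular_map O O (fun A : G => A^-1)%g.
Proof.
have algO := tower_function_algebra.
apply: tower_regular_min => [|k i j|k]; first exact: function_algebra_comp.
  apply: (algebra_ext (f := fun A : G => (\det (A k))^-1 * (\adj (A k)) i j)).
    apply: algebra_mul => //; first exact: tower_regular_detV.
    exact: (algebra_adj algO (@tower_regular_entry k)).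
  by move=> A; rewrite /= ffunE /invmx tower_unit [RHS]mxE.
apply: (algebra_ext (f := fun A : G => \det (A k))).
  exact: (algebra_det algO (@tower_regular_entry k)).
by move=> A; rewrite /= ffunE det_inv invrK.
Qed.

Lemma tower_algebraic_group : algebraic_group O.
Proof.
by split; [apply: tower_affine|apply: tower_mul_regular|apply: tower_inv_regular].
Qed.

Definition tower_component (k : 'I_n.-1) (X : tower_space K n) :
  'M[K]_(k.+2, k.+1) := X k.

Fact tower_component_linear k : linear (@tower_component k).
Proof. by move=> a X Y; rewrite /tower_component !ffunE. Qed.

HB.instance Definition _ k := GRing.isLinear.Build _ _ _ _ (@tower_component k)
  (@tower_component_linear k).

(** The elementary vectors of the direct sum; comparing the indices as natural
    numbers avoids transporting matrices between components. *)
Definition tower_delta k i j : tower_space K n :=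
  [ffun l => \matrix_(a, b) ((l == k) && (a == i :> nat) && (b == j :> nat))%:R].

Lemma tower_space_delta (X : tower_space K n) :
  X = \sum_(k < n.-1) \sum_(i < k.+2) \sum_(j < k.+1) X k i j *: tower_delta k i j.
Proof.
have deltaE l k i j a b : tower_component l (tower_delta k i j) a b =
    ((l == k) && (a == i :> nat) && (b == j :> nat))%:R.
  by rewrite /tower_component ffunE mxE.
apply/ffunP=> l; rewrite -[RHS]/(tower_component l _) linear_sum.
rewrite (bigD1 l) //= [X in _ + X]big1 ?addr0 => [|k /negbTE kl]; last first.
  rewrite linear_sum big1 // => i _; rewrite linear_sum big1 // => j _.
  by apply/matrixP=> a b; rewrite linearZ mxE deltaE mxE eq_sym kl mulr0.
apply/matrixP=> a b; rewrite linear_sum summxE.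
rewrite (bigD1 a) //= [X in _ + X]big1 ?addr0 => [|i /negbTE ia]; last first.
  rewrite linear_sum summxE big1 // => j _.
  by rewrite linearZ mxE deltaE [a == i :> nat]eq_sym [i == a :> nat]ia andbF mulr0.
rewrite linear_sum summxE.
rewrite (bigD1 b) //= [X in _ + X]big1 ?addr0 => [|j /negbTE jb]; last first.
  by rewrite linearZ mxE deltaE [b == j :> nat]eq_sym [j == b :> nat]jb andbF mulr0.
by rewrite linearZ mxE deltaE !eqxx mulr1.
Qed.

Lemma tower_algebra_scalar (X : Type) (P : (X -> K) -> Prop) (F : X -> tower_space K n)
    (phi : {scalar tower_space K n}) :
  function_algebra P -> (forall k, algebra_mx P (fun x => F x k)) ->
  P (fun x => phi (F x)).
Proof.
move=> algP PF; apply: (algebra_ext (f := fun x =>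
  \sum_(k < n.-1) \sum_(i < k.+2) \sum_(j < k.+1)
    F x k i j * phi (tower_delta k i j))); last first.
  move=> x; rewrite [in RHS](tower_space_delta (F x)) linear_sum; apply: eq_bigr => k _.
  rewrite linear_sum; apply: eq_bigr => i _; rewrite linear_sum; apply: eq_bigr => j _.
  by rewrite linearZ.
do 3![apply: algebra_sum => // ? _]; apply: algebra_mul => //; first exact: PF.
exact: algebra_const.
Qed.

Lemma tower_action_rational : rational_representation O (@tower_action K n).
Proof.
have algO := tower_function_algebra.
split=> [X|A B X|A a X Y|X phi].
- by apply/ffunP=> k; rewrite !ffunE trmx1 mul1mx mulmx1.
- by apply/ffunP=> k; rewrite !ffunE trmx_mul !mulmxA.
- apply/ffunP=> k; rewrite !ffunE mulmxDr mulmxDl; congr (_ + _).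
  by rewrite -scalemxAr -scalemxAl.
- apply: tower_algebra_scalar => // k i j.
  apply: (algebra_ext (f := fun A : G =>
    (A (upper k) *m X k *m (A (lower k))^T) i j)); last first.
    by move=> A; rewrite ffunE.
  apply: algebra_mulmx => //; last exact: (algebra_trmx (@tower_regular_entry (lower k))).
  apply: algebra_mulmx => //; first exact: tower_regular_entry.
  exact: algebra_const_mx.
Qed.

End TowerGroup.


(** * Cayley charts on the tower group *)

Section SignMatrix.
Variables (F : fieldType) (n : nat).

Definition sign_mx (s : {ffun 'I_n -> bool}) : 'M[F]_n :=
  diag_mx (\row_i (-1) ^+ s i).

Lemma sign_mx_sqr s : sign_mx s *m sign_mx s = 1%:M.
Proof.
rewrite mulmx_diag; apply/matrixP=> i j; rewrite !mxE.
by rewrite -expr2 sqrr_sign.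
Qed.

Lemma sign_mx_unit s : sign_mx s \in unitmx.
Proof. by case/mulmx1_unit: (sign_mx_sqr s). Qed.

Lemma sign_mx_tr s : (sign_mx s)^T = sign_mx s.
Proof. exact: tr_diag_mx. Qed.

End SignMatrix.

(** The determinant is affine in each diagonal entry. By induction, choose the signs
    that make the complement of the corner nonsingular; the determinants for the
    two choices of the remaining sign then differ by twice a nonzero minor, and
    cannot both vanish. *)
Lemma sign_shift_unitmx (F : fieldType) n (A : 'M[F]_n) :
  (2 : F) != 0 -> exists s, sign_mx F s + A \in unitmx.
Proof.
move=> F2; elim: n A => [|n IH] A.
  by exists [ffun=> true]; rewrite unitmxE det_mx00 unitr1.
have [s' us'] := IH (row' ord0 (col' ord0 A)).
pose s b := [ffun i => if unlift ord0 i is Some j then s' j else b].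
pose M b := sign_mx F (s b) + A.
have cofM b j : cofactor (M b) ord0 j = cofactor (M false) ord0 j.
  rewrite /cofactor; congr (_ * \det _); apply/matrixP=> i k.
  by rewrite !mxE !ffunE liftK.
have corner : cofactor (M false) ord0 ord0 =
    \det (sign_mx F s' + row' ord0 (col' ord0 A)).
  rewrite /cofactor expr0 mul1r; congr (\det _); apply/matrixP=> i j.
  by rewrite !mxE !ffunE liftK (inj_eq lift_inj).
have : \det (M false) - \det (M true) != 0.
  rewrite !(expand_det_row _ ord0) -sumrB (bigD1 ord0) //= big1 => [|j j0].
    rewrite addr0 (cofM true) -mulrBl corner mulf_neq0 //.
      rewrite !mxE !ffunE unlift_none !eqxx expr0 expr1.
      by rewrite opprD addrACA subrr addr0 opprK.
    by rewrite -unitfE -unitmxE.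
  by rewrite (cofM true) -mulrBl !mxE !ffunE eq_sym (negbTE j0) subrr mul0r.
case: (eqVneq (\det (M false)) 0) => [->|detf _]; last first.
  by exists (s false); rewrite unitmxE unitfE.
by rewrite sub0r oppr_eq0 => dett; exists (s true); rewrite unitmxE unitfE.
Qed.

Section Cayley.
Variables (F : fieldType) (n : nat).
Implicit Types A B S : 'M[F]_n.

(** This is [(1 - B) / (1 + B)], written with a single occurrence of [B]. *)
Definition cayley B : 'M[F]_n := 2 *: invmx (1%:M + B) - 1%:M.

Lemma cayley_mul B : 1%:M + B \in unitmx ->
  (1%:M + cayley B) *m (1%:M + B) = 2%:M.
Proof.
by move=> uB; rewrite addrC subrK -scalemxAl mulVmx // scalemx1.
Qed.

Lemma cayley_unit B : (2 : F) != 0 ->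
  1%:M + B \in unitmx -> 1%:M + cayley B \in unitmx.
Proof.
move=> F2 uB; have := congr1 determinant (cayley_mul uB).
rewrite det_mulmx det_scalar unitmxE unitfE => detB.
by apply: contraTneq (expf_neq0 n F2) => d0; rewrite -detB d0 mul0r eqxx.
Qed.

Lemma cayleyK B : (2 : F) != 0 ->
  1%:M + B \in unitmx -> cayley (cayley B) = B.
Proof.
move=> F2 uB; have uK := cayley_unit F2 uB.
rewrite {1}/cayley -mul_mx_scalar -(cayley_mul uB) mulKmx //.
by rewrite addrC addKr.
Qed.

(** For orthogonal [B], [(1 + B^T)^-1 = B (1 + B)^-1], so that the inverses of
    [1 + B^T] and of [1 + B] add up to 1. *)
Lemma cayley_skew B : B^T *m B = 1%:M -> 1%:M + B \in unitmx ->
  (cayley B)^T = - cayley B.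
Proof.
move=> oB uB.
have uBT : 1%:M + B^T \in unitmx by rewrite -trmx1 -linearD /= unitmx_tr.
have BTB : (1%:M + B^T) *m B = 1%:M + B by rewrite mulmxDl mul1mx oB addrC.
have invBT : invmx (1%:M + B^T) = B *m invmx (1%:M + B).
  by rewrite -[LHS](mulmxK uB) -[in X in _ *m X *m _]BTB mulKmx.
have sum1 : invmx (1%:M + B^T) + invmx (1%:M + B) = 1%:M.
  by rewrite invBT -[X in _ + X]mul1mx -mulmxDl addrC mulmxV.
apply/eqP; rewrite -subr_eq0 opprK /cayley linearB linearZ /= trmx1 trmx_inv.
rewrite linearD /= trmx1 addrACA -scalerDr sum1 -opprD scaler_nat -mulr2n.
by rewrite subrr.
Qed.

End Cayley.

Section TowerParametrization.
Variables (K : closedFieldType) (m : nat).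
Hypothesis K2 : (2 : K) != 0.
Local Notation G := (tower_group K m.+1).
Local Notation V := (tower_space K m.+1).

Definition tower_top (A : G) : 'M[K]_m.+1 := A ord_max.

Lemma ord_lower_max (P : 'I_m.+1 -> Prop) :
  (forall k : 'I_m, P (@lower m.+1 k)) -> P ord_max -> forall k, P k.
Proof.
move=> Pl Pm k; case: (unliftP ord_max k) => [j|] -> //.
have -> //: lift ord_max j = @lower m.+1 j.
by apply/val_inj; rewrite /= /bump leqNgt ltn_ord.
Qed.

Lemma tower_top_orthogonal A : (tower_top A)^T *m tower_top A = 1%:M.
Proof.
have /forallP/(_ ord_max) := valP A; rewrite /= eqxx.
by case/andP=> /eqP; rewrite mulmx1.
Qed.

Definition tower_chart (s : {ffun 'I_m.+1 -> bool}) (A : G) : Prop :=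
  1%:M + sign_mx K s *m tower_top A \in unitmx.

Definition tower_cayley (s : {ffun 'I_m.+1 -> bool}) (A : G) : 'M[K]_m.+1 :=
  cayley (sign_mx K s *m tower_top A).

(** Component [k] of the space consists of matrices of size [(k+2, k+1)]: the top
    square holds the [GL] component [A_k], and the last row holds the strictly
    lower part of row [k+1] of the skew Cayley transform. All parameters fit in
    exactly once, so their number is the dimension of the space. *)
Definition tower_parameters (s : {ffun 'I_m.+1 -> bool}) (A : G) : V :=
  [ffun k : 'I_m => \matrix_(i < k.+2, j < k.+1)
     if (i < k.+1)%N then A (@lower m.+1 k) (inord i) j
     else tower_cayley s A (inord i) (inord j)].

Lemma tower_chart_cover A : exists s, tower_chart s A.
Proof.
have [s us] := sign_shift_unitmx (tower_top A) K2; exists s.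
by rewrite /tower_chart -(sign_mx_sqr _ s) -mulmxDr unitmx_mul us sign_mx_unit.
Qed.

Lemma tower_cayley_skew s A i j : tower_chart s A ->
  tower_cayley s A i j = - tower_cayley s A j i.
Proof.
move=> sA; set B := sign_mx K s *m tower_top A.
have oB : B^T *m B = 1%:M.
  rewrite /B trmx_mul sign_mx_tr -mulmxA [sign_mx K s *m _]mulmxA sign_mx_sqr.
  by rewrite mul1mx tower_top_orthogonal.
by have /matrixP/(_ j i) := cayley_skew oB sA; rewrite !mxE.
Qed.

Section Chart.
Variable s : {ffun 'I_m.+1 -> bool}.
Local Notation rational := (rational_in (tower_chart s) (tower_parameters s)).

Let algQ := rational_in_algebra (tower_chart s) (tower_parameters s).

Lemma rational_parameter (k : 'I_m) i j : rational (fun A => tower_parameters s A k i j).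
Proof.
have entry_scalar : scalar (fun X : V => X k i j).
  by move=> a X Y; rewrite !ffunE !mxE.
exact: rational_in_poly (polynomial_function_scalar entry_scalar).
Qed.

(** The parameters contain the entries below the diagonal; skew-symmetry provides
    the others. *)
Lemma rational_cayley : algebra_mx rational (tower_cayley s).
Proof.
have below (i j : 'I_m.+1) : (j < i)%N -> rational (fun A => tower_cayley s A i j).
  case: i => [[|k] ltk] //= lejk; have ltkm : (k < m)%N by [].
  apply: (algebra_ext (@rational_parameter (Ordinal ltkm) ord_max (inord j))) => A.
  rewrite ffunE mxE /= ltnn inordK //; congr (tower_cayley s A _ _).
    by apply/val_inj; rewrite /= inordK.
  by apply/val_inj; rewrite /= inordK.
move=> i j; have [ltij|ltji|/val_inj eqij] := ltngtP i j; last 1 first.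
- apply: (eq_rational_in _ (algebra_const algQ 0)) => A sA.
  have := tower_cayley_skew i j sA; rewrite eqij => /eqP.
  by rewrite -addr_eq0 -mulr2n -mulr_natl mulf_eq0 (negbTE K2) => /eqP.
- apply: (eq_rational_in _ (algebra_opp algQ (below _ _ ltij))) => A sA.
  by rewrite -tower_cayley_skew.
- exact: below.
Qed.

Lemma rational_invmx n (M : G -> 'M[K]_n) :
  (forall A, tower_chart s A -> M A \in unitmx) ->
  algebra_mx rational M -> algebra_mx rational (fun A => invmx (M A)).
Proof.
move=> uM QM i j.
have: rational (fun A => (\det (M A))^-1 * (\adj (M A)) i j).
  apply: (algebra_mul algQ); last exact: algebra_adj.
  apply: rational_in_inv; last exact: algebra_det.
  by move=> A sA; rewrite -unitfE -unitmxE uM.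
by apply: eq_rational_in => A sA; rewrite /invmx uM // [RHS]mxE.
Qed.

(** The Cayley transform being an involution, the orthogonal component is recovered
    rationally from its transform. *)
Lemma rational_tower_entry k : algebra_mx rational (fun A : G => A k).
Proof.
elim/ord_lower_max: k => [k|] i j.
  apply: (algebra_ext (@rational_parameter k (inord i) j)) => A.
  have ik : (i < k.+1)%N := ltn_ord i.
  rewrite ffunE mxE (inordK (leqW ik)) ik.
  by congr (A _ _ _); apply/val_inj; rewrite /= inordK.
have uC A : tower_chart s A -> 1%:M + tower_cayley s A \in unitmx.
  exact: cayley_unit.
have addQ (M N : G -> 'M[K]_m.+1) : algebra_mx rational M ->
    algebra_mx rational N -> algebra_mx rational (fun A => M A + N A).
  move=> QM QN a b.
  by apply: (algebra_ext (algebra_add algQ (QM a b) (QN a b))) => A; rewrite !mxE.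
have : rational (fun A => (sign_mx K s *m cayley (tower_cayley s A)) i j).
  apply: algebra_mulmx => //; first exact: algebra_const_mx.
  apply: (addQ); last exact: algebra_const_mx.
  have QI : algebra_mx rational (fun A => invmx (1%:M + tower_cayley s A)).
    apply: rational_invmx => //; apply: (addQ); last exact: rational_cayley.
    exact: algebra_const_mx.
  move=> a b; apply: (algebra_ext (algebra_mul algQ (algebra_const algQ 2) (QI a b))).
  by move=> A; rewrite [RHS]mxE.
by apply: eq_rational_in => A sA; rewrite cayleyK // mulmxA sign_mx_sqr mul1mx.
Qed.

Lemma rational_tower_regular f : @tower_regular K m.+1 f -> rational f.
Proof.
move: f; apply: tower_regular_min => // k; first exact: rational_tower_entry.
apply: rational_in_inv.
  by move=> A _; rewrite -unitfE -unitmxE tower_unit.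
exact/(algebra_det algQ)/rational_tower_entry.
Qed.

End Chart.

End TowerParametrization.


(** * Gram forms of a tower and orthonormal completion *)

Lemma downward_ind (m : nat) (P : nat -> Prop) :
  P m -> (forall k, (k < m)%N -> P k.+1 -> P k) -> forall k, (k <= m)%N -> P k.
Proof.
move=> Pm Pstep k lekm; rewrite -(subKn lekm).
elim: (m - k)%N (leq_subr k m) => [|d IH] ledm; first by rewrite subn0.
apply: Pstep; first by rewrite ltn_subrL; apply: leq_ltn_trans ledm.
by rewrite -subSn // subSS; apply/IH/ltnW.
Qed.

Lemma closed_sqrt (K : closedFieldType) (a : K) : exists t, t ^+ 2 = a.
Proof.
have [t] := @solve_monicpoly K 2 (nth 0 [:: a; 0]) isT.
by rewrite !big_ord_recl big_ord0 /= mul0r addr0 addr0 mulr1 => ta; exists t.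
Qed.

Lemma adj_unitmx (F : fieldType) n (M : 'M[F]_n) :
  M \in unitmx -> \adj M = \det M *: invmx M.
Proof.
by move=> uM; rewrite /invmx uM scalerA mulfV ?scale1r // -unitfE -unitmxE.
Qed.

Lemma mulmx1_invmx (F : fieldType) n (M N : 'M[F]_n) : M *m N = 1%:M -> N = invmx M.
Proof.
move=> MN; have [uM _] := mulmx1_unit MN.
by rewrite -[N](mulKmx uM) MN mulmx1.
Qed.

Section OrthonormalExtension.
Variables (K : closedFieldType) (p : nat).
Implicit Types (M : 'M[K]_(1 + p)) (Y : 'M[K]_(1 + p, p)) (z : 'cV[K]_(1 + p)).

Lemma orthogonal_vector M Y : exists2 z : 'cV[K]_(1 + p), z != 0 & Y^T *m M *m z = 0.
Proof.
have : kermx (Y^T *m M)^T != 0.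
  by rewrite kermx_eq0 /row_free neq_ltn ltnS rank_leq_col.
case/rowV0Pn=> v /sub_kermxP vW v0; exists v^T; first by rewrite trmx_eq0.
by apply: trmx_inj; rewrite trmx_mul trmxK vW trmx0.
Qed.

(** The orthogonal of the columns of [Y] contains a nonzero [z]. As [row_mx z Y] is
    invertible, the Gram determinant shows that [z] is not isotropic, and it can
    be normalised. Its sign remains free, which settles the determinant when [M]
    is the standard form. *)
Lemma orthonormal_extension M Y : M^T = M -> M \in unitmx ->
  Y^T *m M *m Y = 1%:M ->
  exists z : 'cV[K]_(1 + p), let B := row_mx z Y in
    B^T *m M *m B = 1%:M /\ (M = 1%:M -> \det B = 1).
Proof.
move=> symM uM orthY; have [z z0 Yz] := orthogonal_vector M Y.
have zY : z^T *m M *m Y = 0.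
  by apply: trmx_inj; rewrite !trmx_mul trmxK symM mulmxA Yz trmx0.
pose c := (z^T *m M *m z) 0 0.
pose B a := row_mx (a *: z) Y.
have gramB a : (B a)^T *m M *m B a = block_mx (a ^+ 2 * c)%:M 0 0 1%:M.
  have zT : (a *: z)^T = a *: z^T by rewrite linearZ.
  rewrite tr_row_mx mul_col_mx mul_col_row orthY zT -!scalemxAl -!scalemxAr.
  rewrite zY Yz !scaler0 scalerA -expr2 [z^T *m M *m z]mx11_scalar.
  by rewrite scale_scalar_mx.
have detB a : \det (B a) = a * \det (B 1).
  have -> : B a = B 1 *m block_mx a%:M 0 0 1%:M.
    by rewrite mul_row_block !mulmx0 mulmx1 addr0 add0r scale1r mul_mx_scalar.
  by rewrite det_mulmx det_ublock det1 mulr1 det_scalar1 mulrC.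
have uB : B 1 \in unitmx.
  rewrite -unitmx_tr -row_free_unit -kermx_eq0.
  apply/contraT => /rowV0Pn[u /sub_kermxP uB0 u0].
  have : B 1 *m u^T = 0 by apply: trmx_inj; rewrite trmx_mul trmxK uB0 trmx0.
  rewrite -[u]hsubmxK tr_row_mx mul_row_col scale1r => zaYb.
  have := congr1 (mulmx (Y^T *m M)) zaYb.
  rewrite mulmxDr !mulmxA Yz orthY mul0mx add0r mul1mx mulmx0 => b0.
  move: zaYb; rewrite b0 mulmx0 addr0 [(lsubmx u)^T]mx11_scalar mul_mx_scalar.
  move/eqP; rewrite scaler_eq0 (negbTE z0) orbF => /eqP a0.
  case/eqP: u0; rewrite -[u]hsubmxK -[lsubmx u]trmxK -[rsubmx u]trmxK b0.
  by rewrite [(lsubmx u)^T]mx11_scalar a0 raddf0 !trmx0 row_mx0.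
have detB1 : \det (B 1) ^+ 2 * \det M = c.
  have := congr1 determinant (gramB 1).
  rewrite !det_mulmx det_tr det_ublock det1 det_scalar1 expr1n mul1r mulr1 => <-.
  by rewrite expr2 mulrAC.
have c0 : c != 0.
  by rewrite -detB1 mulf_neq0 ?expf_neq0 // -unitfE -unitmxE.
have [t tc] := closed_sqrt c^-1.
have t0 : t ^+ 2 * c = 1 by rewrite tc mulVf.
(* When M = 1 the factor t * \det (B 1) is the sign det (B t); multiplying t by
   it makes the determinant 1. *)
pose t' := if M == 1%:M then t * (t * \det (B 1)) else t.
exists (t' *: z); rewrite /= -/(B t') gramB detB /t'; split=> [|M1].
  suff -> : (if M == 1%:M then t * (t * \det (B 1)) else t) ^+ 2 * c = 1.
    by rewrite scalar_mx_block.
  case: eqP => // M1; move: detB1; rewrite M1 det1 mulr1 => detB1.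
  by rewrite !exprMn detB1 t0 mulr1 t0.
move: detB1; rewrite M1 eqxx det1 mulr1 => detB1.
by rewrite mulrA -expr2 -mulrA -expr2 detB1.
Qed.

End OrthonormalExtension.

Section GramForms.
Variables (K : closedFieldType).
Implicit Types X : forall k, 'M[K]_(k.+2, k.+1).

(** The forms of the chain, computed downwards from the identity in [d] steps.
    The argument [inv] is either the inverse, which is what the geometry
    requires, or the adjugate, which is polynomial. *)
Fixpoint gram (inv : forall k, 'M[K]_k -> 'M[K]_k) X d k : 'M[K]_k.+1 :=
  if d is d'.+1 then (X k)^T *m inv _ (gram inv X d' k.+1) *m X k else 1%:M.

Definition tower_gram inv X m k := gram inv X (m - k) k.

Lemma tower_gram_top inv X m : tower_gram inv X m m = 1%:M.
Proof. by rewrite /tower_gram subnn. Qed.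

Lemma tower_gramS inv X m k : (k < m)%N ->
  tower_gram inv X m k = (X k)^T *m inv _ (tower_gram inv X m k.+1) *m X k.
Proof. by move=> ltkm; rewrite /tower_gram -subnSK. Qed.

Local Notation S := (tower_gram (fun k (M : 'M[K]_k) => invmx M)).
Local Notation T := (tower_gram (fun k (M : 'M[K]_k) => \adj M)).

Lemma gram_sym X m k : (k <= m)%N -> (S X m k)^T = S X m k.
Proof.
move: k; apply: downward_ind => [|k ltkm IH]; first by rewrite tower_gram_top trmx1.
by rewrite tower_gramS // !trmx_mul trmxK trmx_inv IH mulmxA.
Qed.

(** The adjugate of an invertible matrix is a multiple of its inverse, and a scalar
    factor on one form of the chain only rescales the later ones. *)
Lemma gram_adj_invmx X m : (forall k, (k <= m)%N -> T X m k \in unitmx) ->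
  forall k, (k <= m)%N -> exists2 c, c != 0 & S X m k = c *: T X m k.
Proof.
move=> uT; apply: downward_ind => [|k ltkm [c c0 ScT]].
  by exists 1; rewrite ?oner_eq0 // !tower_gram_top scale1r.
have uTk := uT k.+1 ltkm; have detT : \det (T X m k.+1) != 0.
  by rewrite -unitfE -unitmxE.
exists (c * \det (T X m k.+1))^-1; first by rewrite invr_eq0 mulf_neq0.
rewrite 2!(tower_gramS _ _ ltkm) adj_unitmx // ScT invmxZ ?unitfE //; last first.
  by rewrite unitmxZ ?unitfE.
rewrite -!scalemxAr -!scalemxAl scalerA; congr (_ *: _).
by rewrite invfM -mulrA mulVf ?mulr1.
Qed.

Definition frame k : 'M[K]_(k.+2, k.+1) := col_mx (0 : 'M_(1, _)) 1%:M.

Lemma frame_orthonormal k : (frame k)^T *m frame k = 1%:M.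
Proof.
have blocks : (col_mx (0 : 'M[K]_(1, k.+1)) 1%:M)^T *m col_mx (0 : 'M_(1, _)) 1%:M
    = 1%:M :> 'M_k.+1.
  by rewrite tr_col_mx mul_row_col trmx0 mul0mx add0r trmx1 mulmx1.
exact: blocks.
Qed.

Lemma row_mx_frame k (z : 'cV[K]_(1 + k.+1)) (Y : 'M_(1 + k.+1, k.+1)) :
  (row_mx z Y : 'M_k.+2) *m frame k = Y.
Proof.
have blocks : row_mx z Y *m col_mx 0 1%:M = Y.
  by rewrite mul_row_col mulmx0 add0r mulmx1.
exact: blocks.
Qed.

(** On the orbit of the frames the forms are [A_k *m (A_k)^T] up to nonzero
    scalars. *)
Lemma gram_orbit X (A : forall k, 'M[K]_k.+1) m :
  (forall k, (k <= m)%N -> A k \in unitmx) -> A m *m (A m)^T = 1%:M ->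
  (forall k, (k < m)%N -> X k = A k.+1 *m frame k *m (A k)^T) ->
  forall k, (k <= m)%N -> T X m k \in unitmx.
Proof.
move=> uA oA XA k lekm.
suff [c c0 ->] : exists2 c, c != 0 & T X m k = c *: (A k *m (A k)^T).
  by rewrite unitmxZ ?unitfE // unitmx_mul unitmx_tr uA.
move: k lekm; apply: downward_ind => [|k ltkm [c c0 IH]].
  by exists 1; rewrite ?oner_eq0 // tower_gram_top oA scale1r.
have uAk := uA _ ltkm; set B := A k.+1 in uAk IH.
have uN : c *: (B *m B^T) \in unitmx.
  by rewrite unitmxZ ?unitfE // unitmx_mul unitmx_tr uAk.
exists (\det (c *: (B *m B^T)) / c).
  by rewrite mulf_neq0 ?invr_eq0 // -unitfE -unitmxE.
rewrite tower_gramS // IH adj_unitmx // XA // -/B.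
have -> : invmx (c *: (B *m B^T)) = c^-1 *: (invmx B^T *m invmx B).
  apply/esym/mulmx1_invmx; rewrite -scalemxAl -scalemxAr scalerA mulfV // scale1r.
  by rewrite -mulmxA mulKVmx ?unitmx_tr // mulmxV.
rewrite scalerA -scalemxAr -scalemxAl; congr (_ *: _).
rewrite !trmx_mul trmxK -!mulmxA; congr (_ *m _).
rewrite mulKmx // mulKVmx ?unitmx_tr //.
by rewrite mulmxA frame_orthonormal mul1mx.
Qed.

(** The factors are built from the smallest one upwards, each one determining the
    columns of the next but one; the top one has determinant 1 because its form
    is the identity. *)
Lemma gram_transitive X m : (forall k, (k <= m)%N -> S X m k \in unitmx) ->
  exists A : forall k, 'M[K]_k.+1,
  [/\ forall k, (k <= m)%N -> A k *m (A k)^T = S X m k,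
      forall k, (k < m)%N -> X k = A k.+1 *m frame k *m (A k)^T
    & \det (A m) = 1].
Proof.
move=> uS.
have extend k (Y : 'M[K]_(1 + k, k)) : (k <= m)%N ->
    Y^T *m invmx (S X m k) *m Y = 1%:M ->
    exists z : 'cV[K]_(1 + k), let B : 'M_k.+1 := row_mx z Y in
      B *m B^T = S X m k /\ (S X m k = 1%:M -> \det B = 1).
  move=> lekm orthY.
  have symM : (invmx (S X m k))^T = invmx (S X m k) by rewrite trmx_inv gram_sym.
  have uM : invmx (S X m k) \in unitmx by rewrite unitmx_inv uS.
  have [z [orthB detB]] := orthonormal_extension symM uM orthY.
  exists z => /=; split=> [|S1]; last by apply: detB; rewrite S1 invmx1.
  have := mulmx1C orthB; rewrite mulmxA => /mulmx1_invmx invS.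
  by rewrite -[RHS]invmxK invS invmxK.
(* Boolean, so that the choice of each factor can be iterated by recursion. *)
pose good k (B : 'M[K]_k.+1) :=
  (B *m B^T == S X m k) && ((k == m) ==> (\det B == 1)).
have goodP k (Y : 'M[K]_(1 + k, k)) : (k <= m)%N ->
    Y^T *m invmx (S X m k) *m Y = 1%:M -> exists z : 'cV[K]_(1 + k), good k (row_mx z Y).
  move=> lekm /(extend _ _ lekm)[z [BB detB]]; exists z.
  rewrite /good BB eqxx; apply/implyP => /eqP km; apply/eqP/detB.
  by move: km => ->; exact: tower_gram_top.
have good0 : exists B, good 0%N B.
  have [//||z goodz] := goodP 0%N 0; last by exists (row_mx z 0).
  by apply/matrixP=> -[].
have goodS k (B : 'M[K]_k.+1) : exists C : 'M[K]_k.+2,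
    (k < m)%N && good k B ==> good k.+1 C && (X k == C *m frame k *m B^T).
  have [/andP[ltkm /andP[/eqP BB _]]|_] /= := boolP ((k < m)%N && good k B); last first.
    by exists 0.
  have uBB : B *m B^T \in unitmx by rewrite BB uS // ltnW.
  have uB : B \in unitmx by move: uBB; rewrite unitmx_mul => /andP[].
  have uBT : B^T \in unitmx by rewrite unitmx_tr.
  have [||z goodz] := goodP k.+1 (X k *m invmx B^T) => //.
    have Sk : S X m k = (X k)^T *m invmx (S X m k.+1) *m X k := tower_gramS _ _ ltkm.
    rewrite trmx_mul trmx_inv trmxK.
    transitivity (invmx B *m ((X k)^T *m invmx (S X m k.+1) *m X k) *m invmx B^T).
      by rewrite !mulmxA.
    by rewrite -Sk -BB mulKmx // mulmxV.
  by exists (row_mx z (X k *m invmx B^T)); rewrite goodz row_mx_frame mulmxKV ?eqxx.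
pose A := nat_rect (fun k => 'M[K]_k.+1) (xchoose good0)
  (fun k B => xchoose (goodS k B)).
have step k : (k < m)%N -> good k (A k) ->
    good k.+1 (A k.+1) /\ X k = A k.+1 *m frame k *m (A k)^T.
  move=> ltkm goodA; have /implyP/(_ _)/andP[|? /eqP] := xchooseP (goodS k (A k)).
    by rewrite ltkm.
  by split.
have goodA k : (k <= m)%N -> good k (A k).
  elim: k => [_|k IH ltkm]; first exact: xchooseP good0.
  by case: (step k ltkm (IH (ltnW ltkm))).
exists A; split=> [k lekm|k ltkm|].
- by case/andP: (goodA k lekm) => /eqP.
- by case: (step k ltkm (goodA k (ltnW ltkm))).
- by have /andP[_] := goodA m (leqnn m); rewrite eqxx => /eqP.
Qed.

End GramForms.


(** * The open orbit *)

(** Finite families are extended to all natural indices, where the size of the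
    next matrix is [k.+2] by computation and recursion on the index is possible. *)
Definition extend_family (T : nat -> Type) (x0 : forall k, T k) (m : nat)
    (f : forall k : 'I_m, T k) (k : nat) : T k :=
  if (k < m)%N =P true is ReflectT h then f (Ordinal h) else x0 k.

Lemma extend_familyE (T : nat -> Type) (x0 : forall k, T k) (m : nat)
    (f : forall k : 'I_m, T k) (k : 'I_m) : extend_family x0 f k = f k.
Proof.
case: k => k h; rewrite /extend_family /=; case: eqP => [h'|//].
by rewrite (bool_irrelevance h' h).
Qed.

Section OpenOrbit.
Variables (K : closedFieldType) (m : nat).
Local Notation G := (tower_group K m.+1).
Local Notation V := (tower_space K m.+1).
Local Notation T := (tower_gram (fun k (M : 'M[K]_k) => \adj M)).

Definition extend_space (X : V) : forall k, 'M[K]_(k.+2, k.+1) :=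
  extend_family (T := fun k => 'M[K]_(k.+2, k.+1)) (fun k => 0) (fun k : 'I_m => X k).

Lemma extend_spaceE X (k : 'I_m) : extend_space X k = X k.
Proof. exact: (extend_familyE (T := fun k => 'M[K]_(k.+2, k.+1))). Qed.

Definition tower_frame : V := [ffun k : 'I_m => frame K k].

(** Its non-vanishing locus is the orbit of [tower_frame]. *)
Definition tower_semi_invariant (X : V) : K :=
  \prod_(k < m.+1) \det (T (extend_space X) m k).

Lemma tower_semi_invariant_neq0P X :
  reflect (forall k, (k <= m)%N -> T (extend_space X) m k \in unitmx)
          (tower_semi_invariant X != 0).
Proof.
apply: (iffP (prodf_neq0 _ _)) => [detT k lekm|uT k _].
  by have := detT (Ordinal (lekm : (k < m.+1)%N)) isT; rewrite unitmxE unitfE.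
by rewrite -unitfE -unitmxE uT // -ltnS ltn_ord.
Qed.

Lemma polynomial_extend_space k :
  algebra_mx (@polynomial_function K V) (fun X => extend_space X k).
Proof.
move=> i j; apply: polynomial_function_scalar => a X Y.
rewrite /extend_space /extend_family; case: eqP => [h|_].
  by rewrite !ffunE !mxE.
by rewrite !mxE mulr0 addr0.
Qed.

Lemma polynomial_tower_semi_invariant :
  polynomial_function tower_semi_invariant.
Proof.
have algV := @polynomial_function_algebra K V.
have poly_gram d k : algebra_mx (@polynomial_function K V)
    (fun X => gram (fun k (M : 'M[K]_k) => \adj M) (extend_space X) d k).
  elim: d k => [|d IH] k; first exact: (algebra_const_mx algV 1%:M).
  apply: algebra_mulmx => //; last exact: (@polynomial_extend_space k).
  apply: algebra_mulmx => //; last exact: (algebra_adj algV (IH k.+1)).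
  exact: (algebra_trmx (@polynomial_extend_space k)).
apply: algebra_prod => // k _; apply: algebra_det => //; exact: poly_gram.
Qed.

Lemma tower_semi_invariant_orbit (A : G) :
  tower_semi_invariant (tower_action A tower_frame) != 0.
Proof.
apply/tower_semi_invariant_neq0P.
pose A' := extend_family (T := fun k => 'M[K]_k.+1) (fun k => 0) (fun k => A k).
have A'E (k : 'I_m.+1) : A' k = A k.
  exact: (extend_familyE (T := fun k => 'M[K]_k.+1)).
have X'E (k : 'I_m) : extend_space (tower_action A tower_frame) k =
    A' k.+1 *m frame K k *m (A' k)^T.
  by rewrite extend_spaceE !ffunE -!A'E.
apply: (@gram_orbit _ _ A') => [k lekm||k ltkm].
- rewrite (A'E (Ordinal (lekm : (k < m.+1)%N))).
  exact: (tower_unit A (Ordinal (lekm : (k < m.+1)%N))).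
- by rewrite (A'E ord_max); exact/mulmx1C/tower_top_orthogonal.
- exact: (X'E (Ordinal ltkm)).
Qed.

Lemma tower_orbit_full X : tower_semi_invariant X != 0 ->
  exists A : G, X = tower_action A tower_frame.
Proof.
move/tower_semi_invariant_neq0P=> uT.
have uS k : (k <= m)%N ->
    tower_gram (fun k (M : 'M[K]_k) => invmx M) (extend_space X) m k \in unitmx.
  move=> lekm; have [c c0 ->] := gram_adj_invmx uT lekm.
  by rewrite unitmxZ ?unitfE ?uT.
have [A [AA XA detA]] := gram_transitive uS.
have towerA : in_tower [ffun k : 'I_m.+1 => A k].
  apply/forallP=> k; rewrite ffunE.
  have AAk := AA k (ltn_ord k : (k <= m)%N).
  case: ifP => [/eqP[km]|_]; last first.
    have : A k *m (A k)^T \in unitmx by rewrite AAk uS // -ltnS.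
    by rewrite unitmx_mul => /andP[].
  have -> : k = ord_max by apply: val_inj.
  rewrite /special_orthogonal mulmx1 detA eqxx andbT; apply/eqP/mulmx1C.
  by rewrite AA // tower_gram_top.
exists (TowerGroup towerA); apply/ffunP=> k.
by rewrite !ffunE -extend_spaceE XA.
Qed.

Lemma tower_orbitP X :
  (exists A : G, X = tower_action A tower_frame) <-> tower_semi_invariant X != 0.
Proof.
split=> [[A ->]|]; [exact: tower_semi_invariant_orbit|exact: tower_orbit_full].
Qed.

Lemma tower_orbit_open :
  zariski_open (fun X => exists A : G, X = tower_action A tower_frame).
Proof.
exists (fun f => f = tower_semi_invariant); split=> [_ ->|X].
  exact: polynomial_tower_semi_invariant.
split=> [notX _ ->|F0 /tower_orbitP]; last by rewrite F0 ?eqxx.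
by apply/eqP/negPn/negP => /tower_orbitP.
Qed.

Lemma tower_dimension : (2 : K) != 0 ->
  has_dimension (@tower_regular K m.+1) (\dim {:V}).
Proof.
move=> K2; split.
  exists (fun i A => coords (tower_action A tower_frame) i); split=> [i|].
    have [_ _ _ ratV] := @tower_action_rational K m.+1.
    exact: ratV (coord (vbasis {:V}) i : {scalar V}).
  apply: (dominant_map_independent polynomial_tower_semi_invariant).
    by exists (tower_action 1%g tower_frame); apply: tower_semi_invariant_orbit.
  by move=> X /tower_orbit_full.
move=> e f Of; apply: (independent_size (tower_chart_cover K2)) => i s.
exact: rational_tower_regular.
Qed.

End OpenOrbit.

(** Characteristic 2 is excluded for the sake of the Cayley transform. *)
Theorem tower_etale_module (K : closedFieldType) (m : nat) : (2 : K) != 0 ->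
  etale_module (@tower_regular K m.+1) (@tower_action K m.+1).
Proof.
move=> K2; split; [exact: tower_algebraic_group|exact: tower_action_rational| |].
  exists (tower_frame K m); exact: tower_orbit_open.
exact: tower_dimension.
Qed.

Theorem theorem2p8 (R : realType) (n : nat) (hn : (2 <= n)%N) :
  etale_module (K := R[i]) (G := tower_group R[i] n)
    (@tower_regular R[i] n) (V := tower_space R[i] n) (@tower_action R[i] n).
Proof.
case: n hn => // m _; apply: tower_etale_module.
by rewrite Num.Theory.pnatr_eq0.
Qed.
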